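(* Let $N=(P,T,F)$ be a structurally live net of one of the types listed below, with maximum edge-weight $w$ (where $w=1$ if $N$ is ordinary). Define the bounds $(B_1,B_2)$ according to the type: for ord-IO and ord-IMO nets, $(B_1,B_2)=(1,\,2|P|)$; for IO nets, $(B_1,B_2)=(2,\,4|P|)$; for IMO nets, $(B_1,B_2)=(w,\,2w|P|)$; for ord-BIO and ord-BIMO nets, $(B_1,B_2)=(|P|,\,2|P|)$; for BIO and BIMO nets, $(B_1,B_2)=(w|P|,\,2w|P|)$. Then: 1. there is a live marking $M$ of $N$ with $M(p)\le B_1$ for every $p\in P$; 2. whether or not a marking $M$ of $N$ is live is determined by the restriction of $M$ to the set $P'=\{p\in P\mid M(p)<B_2\}$; equivalently, the (non)liveness of any marking does not change if each value $M(p)$ greater than $B_2$ is replaced by $B_2$.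
   Context: A net is $N=(P,T,F)$ with $P,T$ finite disjoint sets of places and transitions and $F:(P\times T)\cup(T\times P)\to\mathbb{N}$ (edge weights); $N$ is ordinary if all weights are in $\{0,1\}$. Pre-multiset ${}^\bullet t(p)=F(p,t)$, post-multiset $t^\bullet(p)=F(t,p)$. Markings $M:P\to\mathbb{N}$; $t$ is enabled at $M$ if $M\ge {}^\bullet t$ componentwise, and firing gives $M'=M-{}^\bullet t+t^\bullet$. A transition is dead at $M$ if it is enabled at no marking reachable from $M$, live at $M$ if not dead at any marking reachable from $M$; $M$ is live if all transitions are live at $M$; $N$ is structurally live if some marking of $N$ is live. For multisets, $(A-B)(p)=\max(A(p)-B(p),0)$ and $|A|=\sum_p A(p)$. A transition $t$ is a BIMO transition if $|{}^\bullet t-t^\bullet|\le 1$ (if ${}^\bullet t=\emptyset$ one assumes an extra always-marked dummy place that $t$ consumes and returns). Each BIMO transition has a presentation ${}^\bullet t=\{p_s\}+O$, $t^\bullet=O+D$ for a place $p_s$ (source) and multisets $O$ (observation places) and $D$ (destination places). $t$ is a BIO transition if $|O|\le 1$; an IMO transition if $|D|=1$; an IO transition if both. For X among BIMO, BIO, IMO, IO, an X net is a net all of whose transitions are X transitions, and an ord-X net is an ordinary X net. *)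

(* Defs.v *)
From mathcomp Require Import all_boot zify.
From Stdlib Require Import Relation_Operators.
Set Implicit Arguments.
Unset Strict Implicit.
Unset Printing Implicit Defensive.

Local Open Scope nat_scope.

Section Multisets.

Variable A : finType.

Definition multiset := {ffun A -> nat}.

Definition msingle (a : A) : multiset := [ffun x => nat_of_bool (x == a)].

Definition madd (X Y : multiset) : multiset := [ffun a => X a + Y a].

(* Subtraction on nat is truncated: this is max(X a - Y a, 0). *)
Definition mdiff (X Y : multiset) : multiset := [ffun a => X a - Y a].

Definition msize (X : multiset) : nat := \sum_a X a.

End Multisets.

(* The flow F : (P x T) u (T x P) -> nat; the disjointness of P and T is built
   into the sum type. *)
Record net (P T : finType) := Net { weight : P * T + T * P -> nat }.

Section Semantics.

Variables P T : finType.
Implicit Types (N : net P T) (t : T) (p : P).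

Definition pre N t : multiset P := [ffun p => weight N (inl (p, t))].
Definition post N t : multiset P := [ffun p => weight N (inr (t, p))].

Definition ordinary N : bool := [forall x, weight N x <= 1].

(* The maximum edge weight, taken to be 1 for every ordinary net (including a
   net without edges). *)
Definition max_weight N : nat :=
  if ordinary N then 1 else \max_x weight N x.

Definition marking := multiset P.
Implicit Types M : marking.

Definition enabled N M t : bool := [forall p, pre N t p <= M p].

Definition fire N M t : marking := madd (mdiff M (pre N t)) (post N t).

Definition step N M M' : Prop := exists2 t, enabled N M t & M' = fire N M t.

Definition reachable N : marking -> marking -> Prop :=
  clos_refl_trans marking (step N).

Definition dead_transition N M t : Prop :=
  forall M', reachable N M M' -> ~~ enabled N M' t.

Definition live_transition N M t : Prop :=
  forall M', reachable N M M' -> ~ dead_transition N M' t.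

Definition live N M : Prop := forall t, live_transition N M t.

Definition structurally_live N : Prop := exists M, live N M.

(* The multisets of t over the places of P extended with a dummy place, None,
   which is consumed and put back by exactly the transitions with an empty
   pre-multiset.  The dummy place only serves to give these transitions a
   source: it is not a place of the net, and it is not counted in #|P|. *)
Definition dummy_extend N t (X : multiset P) : multiset (option P) :=
  [ffun q => if q is Some p then X p
             else nat_of_bool [forall p, pre N t p == 0]].

Definition presentation N t (s : option P) (O D : multiset (option P)) : Prop :=
  dummy_extend N t (pre N t) = madd (msingle s) O /\
  dummy_extend N t (post N t) = madd O D.

Definition BIMO_transition N t : Prop := msize (mdiff (pre N t) (post N t)) <= 1.

(* The sizes of O and D do not depend on the presentation of t, and a transition
   with a presentation is a BIMO transition (see BIMO_transitionP below). *)
Definition BIO_transition N t : Prop :=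
  exists s O D, presentation N t s O D /\ msize O <= 1.

Definition IMO_transition N t : Prop :=
  exists s O D, presentation N t s O D /\ msize D = 1.

Definition IO_transition N t : Prop := BIO_transition N t /\ IMO_transition N t.

Lemma BIMO_transitionP N t :
  BIMO_transition N t <-> exists s O D, presentation N t s O D.
Proof.
split=> [h | [s [O [D [/ffunP hpre /ffunP hpost]]]]]; last first.
  have hle p : pre N t p - post N t p <= (Some p == s).
    have := hpre (Some p); have := hpost (Some p); rewrite !ffunE => -> ->.
    by rewrite leq_subLR addnAC [_ + O _]addnC leq_addr.
  apply: (@leq_trans (\sum_p (Some p == s))).
    by apply: leq_sum => p _; have := hle p; rewrite !ffunE.
  case: s {hpre hpost hle} => [q|]; last by rewrite big1.
  rewrite (bigD1 q) //= eqxx big1 // => p /negPf np.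
  by rewrite (inj_eq Some_inj) np.
suff [s hs]: exists s, forall q,
    (q == s) <= dummy_extend N t (pre N t) q
             <= (q == s) + dummy_extend N t (post N t) q.
  pose O := mdiff (dummy_extend N t (pre N t)) (msingle s).
  exists s, O, (mdiff (dummy_extend N t (post N t)) O).
  split; apply/ffunP => q; have /andP[h1 h2] := hs q; rewrite /O [RHS]ffunE.
    by rewrite [X in _ + X]ffunE [msingle s q]ffunE subnKC.
  rewrite [mdiff _ (mdiff _ _) q]ffunE [mdiff _ (msingle s) q]ffunE.
  by rewrite [msingle s q]ffunE subnKC // leq_subLR.
have [e0|ne] := boolP [forall p, pre N t p == 0].
  exists None => -[p|]; rewrite !ffunE /= ?e0 //.
  by have := forallP e0 p; rewrite ffunE; lia.
suff [p hp]: exists p, forall q, (q == p) <= pre N t q <= (q == p) + post N t q.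
  exists (Some p) => -[q|]; rewrite !ffunE ?(negPf ne) //.
  by have := hp q; rewrite (inj_eq Some_inj) !ffunE.
have [p hp|no] := pickP (fun p => post N t p < pre N t p).
  exists p => q; have [->|nq] := eqVneq q p.
    move: h; rewrite /BIMO_transition /msize (bigD1 p) //= [X in X + _]ffunE.
    by move=> /(leq_trans (leq_addr _ _)); lia.
  move: h; rewrite /BIMO_transition /msize (bigD1 p) //= (bigD1 q) //=.
  rewrite ![mdiff _ _ _]ffunE addnA => /(leq_trans (leq_addr _ _)).
  by move: hp; lia.
have /forallPn [p hp] := ne.
by exists p => q; have := no q; case: eqVneq => [->|]; lia.
Qed.

End Semantics.

Variant net_type :=
  | OrdIO | OrdIMO | IO | IMO | OrdBIO | OrdBIMO | BIO | BIMO.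

Section NetTypes.

Variables P T : finType.
Implicit Type N : net P T.

Definition has_type N (ty : net_type) : Prop :=
  match ty with
  | OrdIO => ordinary N /\ forall t, IO_transition N t
  | OrdIMO => ordinary N /\ forall t, IMO_transition N t
  | IO => forall t, IO_transition N t
  | IMO => forall t, IMO_transition N t
  | OrdBIO => ordinary N /\ forall t, BIO_transition N t
  | OrdBIMO => ordinary N /\ forall t, BIMO_transition N t
  | BIO => forall t, BIO_transition N t
  | BIMO => forall t, BIMO_transition N t
  end.

Definition bounds N (ty : net_type) : nat * nat :=
  let w := max_weight N in
  match ty with
  | OrdIO | OrdIMO => (1, 2 * #|P|)
  | IO => (2, 4 * #|P|)
  | IMO => (w, 2 * w * #|P|)
  | OrdBIO | OrdBIMO => (#|P|, 2 * #|P|)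
  | BIO | BIMO => (w * #|P|, 2 * w * #|P|)
  end.

Definition small_places (B : nat) (M : marking P) : {set P} :=
  [set p | M p < B].

Definition cap (B : nat) (M : marking P) : marking P :=
  [ffun p => if B < M p then B else M p].

End NetTypes.

(* Main.v *)
(* Let w bound all weights of edges into transitions, call the tokens in excess
   of w on a place superfluous, and let the spread of a marking be the number of
   the other tokens.  In a run from a marking of maximal spread, the superfluous
   tokens need not be touched: drop from the run every transition that can be
   dropped, and count.
   From every marking one reaches a steady marking X: every transition is dead
   or live, the spread is maximal, and the truncation of X to w recurs.  The
   places that can be made to hold a superfluous token without loss of spread
   form a set R that no token leaves; all of them hold at least w tokens of X,
   and all the others at most w.  Hence tokens added to X on R never revive a
   dead transition, and if X has a dead transition then fewer than w|P| tokens
   lie outside R.  So if a non-live M reaches such an X, fewer than w|P| tokens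
   of M have a descendant outside R.
   If M holds at least 2w|P| tokens on some places, at least w|P| of these on
   each place have all their descendants in R; such tokens serve only to keep
   the visited places marked, and w|P| of them suffice for that.  This gives the
   second bound.  For the first one, remove a token from a place p with more
   than w|P| tokens of a live marking: if the result were not live, the token,
   put back, could follow a token from p into R, and M would not be live.
   In IMO nets, take p with more than w tokens in a steady live marking.  A
   superfluous token on p can be moved to every place of the closure C of p
   under the edges of the net.  If removing it destroys liveness, then either
   some token on C ends in R, and the superfluous one can follow it, or in the
   end all places of C hold w tokens, and the superfluous one is of no use. *)
Require Import Defs.
From mathcomp Require Import all_boot zify.
From Stdlib Require Import Relation_Operators Classical ClassicalEpsilon.
Set Implicit Arguments.
Unset Strict Implicit.
Unset Printing Implicit Defensive.

Local Open Scope nat_scope.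

Lemma leq_sum_eq (I : finType) (E F : I -> nat) :
  (forall i, E i <= F i) -> \sum_i F i <= \sum_i E i -> forall i, E i = F i.
Proof.
move=> leEF leS i; apply/eqP.
have [_] := leqif_sum (fun i (_ : true) => leqif_eq (leEF i)).
by rewrite eqn_leq leS leq_sum //= => /esym/forallP/(_ i).
Qed.

Lemma sum_pred1 (I : finType) (A : {set I}) (i : I) :
  \sum_(j in A) (j == i) = (i \in A).
Proof.
have [iA|niA] := boolP (i \in A).
  by rewrite (bigD1 i) //= eqxx big1 // => j /andP[_ /negPf->].
by rewrite big1 // => j jA; case: eqVneq => // ji; rewrite -ji jA in niA.
Qed.

Lemma sum_pred1T (I : finType) (i : I) : \sum_j (j == i) = 1.
Proof. by rewrite (bigD1 i) //= eqxx big1 // => j /negPf->. Qed.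

Lemma finite_comprehension (I : finType) (Q : I -> Prop) :
  exists A : {set I}, forall i, i \in A <-> Q i.
Proof.
exists [set i | if excluded_middle_informative (Q i) then true else false] => i.
by rewrite inE; case: excluded_middle_informative.
Qed.

(** * Runs *)

Section Firing.

Variables (P T : finType) (N : net P T).
Implicit Types (M X Y Z : marking P) (t : T) (p q : P) (ts : seq T).

Definition loss t p := pre N t p - post N t p.
Definition gain t p := post N t p - pre N t p.

Lemma fireE M t p : fire N M t p = M p - pre N t p + post N t p.
Proof. by rewrite [LHS]ffunE [X in X + _]ffunE. Qed.

Lemma enabledP M t : reflect (forall p, pre N t p <= M p) (enabled N M t).
Proof. exact: forallP. Qed.

Fixpoint firable M ts :=
  if ts is t :: ts' then enabled N M t && firable (fire N M t) ts' else true.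

Fixpoint after M ts := if ts is t :: ts' then after (fire N M t) ts' else M.

Lemma reach_refl M : reachable N M M.
Proof. exact: rt_refl. Qed.

Lemma reach_trans M X Y :
  reachable N M X -> reachable N X Y -> reachable N M Y.
Proof. exact: rt_trans. Qed.

Lemma reach_fire M t : enabled N M t -> reachable N M (fire N M t).
Proof. by move=> en; apply: rt_step; exists t. Qed.

Lemma reach_after M ts : firable M ts -> reachable N M (after M ts).
Proof.
elim: ts M => [|t ts IH] M /=; first by move=> _; apply: reach_refl.
by move=> /andP[/reach_fire h /IH]; apply: reach_trans.
Qed.

Lemma firable_cat M ts us :
  firable M ts -> firable (after M ts) us -> firable M (ts ++ us).
Proof. by elim: ts M => //= t ts IH M /andP[-> /IH h] /h. Qed.

Lemma after_cat M ts us : after M (ts ++ us) = after (after M ts) us.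
Proof. by elim: ts M => /=. Qed.

Lemma reachP M X :
  reachable N M X -> exists2 ts, firable M ts & X = after M ts.
Proof.
elim=> [Y Z [t en ->]|Y|X1 X2 X3 _ [ts f1 ->] _ [us f2 ->]].
- by exists [:: t] => //=; rewrite en.
- by exists [::].
- by exists (ts ++ us); [apply: firable_cat | rewrite after_cat].
Qed.

Lemma not_dead M t : ~ dead_transition N M t ->
  exists2 Y, reachable N M Y & enabled N Y t.
Proof.
move=> nd; apply: NNPP => h; apply: nd => Y rY; apply/negP => en.
by apply: h; exists Y.
Qed.

Lemma dead_reach M X t :
  reachable N M X -> dead_transition N M t -> dead_transition N X t.
Proof. by move=> r d Y /(reach_trans r)/d. Qed.

Lemma live_transition_reach M X t :
  reachable N M X -> live_transition N M t -> live_transition N X t.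
Proof. by move=> r d Y /(reach_trans r)/d. Qed.

Lemma live_reach M X : reachable N M X -> live N M -> live N X.
Proof. by move=> r l t; apply: live_transition_reach (l t). Qed.

(* Firing [t] repeatedly only consumes its net loss; the rest of its
   pre-multiset is put back each time. *)
Lemma fire_iter t n M :
  (forall p, n * loss t p + minn (pre N t p) (post N t p) <= M p) ->
  exists2 M', reachable N M M' &
    forall p, M' p + n * loss t p = M p + n * gain t p.
Proof.
elim: n M => [|n IH] M hM; first by exists M => //; apply: reach_refl.
have en : enabled N M t.
  by apply/enabledP => p; have := hM p; rewrite /loss; nia.
case: (IH (fire N M t)) => [p|M' r hM'].
  by rewrite fireE; have := hM p; have := enabledP _ _ en p; rewrite /loss; nia.
exists M'; first exact: reach_trans (reach_fire en) r.
move=> p; have := hM' p; rewrite fireE.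
by have := enabledP _ _ en p; rewrite /loss /gain; nia.
Qed.

End Firing.

Section Capped.

Variables (P T : finType) (N : net P T) (w : nat).
Hypothesis bimo : forall t, BIMO_transition N t.
Hypothesis pre_le : forall t p, pre N t p <= w.
Implicit Types (M X Y Z : marking P) (t : T) (p q : P) (ts : seq T).

Notation loss := (loss N).
Notation gain := (gain N).
Notation firable := (firable N).
Notation after := (after N).
Notation reach := (reachable N).

Lemma sum_loss t : \sum_p loss t p <= 1.
Proof.
apply: leq_trans (bimo t); rewrite /msize; apply: leq_sum => p _.
by rewrite [mdiff _ _ _]ffunE.
Qed.

Lemma sum_loss_in t (C : {set P}) : \sum_(p in C) loss t p <= 1.
Proof. by apply: leq_trans (sum_loss t); rewrite [leqRHS](bigID (mem C)) leq_addr. Qed.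

Lemma loss_uniq t p q : 0 < loss t p -> loss t q = (q == p).
Proof.
move=> lp; have := sum_loss t; rewrite (bigD1 p) //=.
have [->|qp] := eqVneq q p; first lia.
by rewrite (bigD1 q) //=; lia.
Qed.

Lemma loss_le1 t p : loss t p <= 1.
Proof. by have := @loss_uniq t p p; case: (loss t p) => // n -> //; rewrite eqxx. Qed.

(** * Runs without superfluous steps *)

(** Comparison after cutting off at [w]: tokens beyond [w] never matter for enabling, since [w]
    bounds all input weights. *)
Definition dominates X Y := forall p, minn (Y p) w <= X p.

Definition spread X := \sum_p minn (X p) w.

Lemma dominates_enabled X Y t : dominates X Y -> enabled N Y t -> enabled N X t.
Proof.
move=> d /enabledP en; apply/enabledP => p.
by have := d p; have := en p; have := pre_le t p; lia.
Qed.

Lemma dominates_trans X Y Z : dominates X Y -> dominates Y Z -> dominates X Z.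
Proof. by move=> h1 h2 p; have := h1 p; have := h2 p; lia. Qed.

Lemma dominates_spread X Y : dominates X Y -> spread X <= spread Y ->
  forall p, minn (Y p) w = minn (X p) w.
Proof. by move=> d le; apply: leq_sum_eq le => p; have := d p; lia. Qed.

Fixpoint low M ts : P -> nat :=
  if ts is t :: ts' then fun p => minn (M p) (low (fire N M t) ts' p) else M.

Lemma low_le M ts p : low M ts p <= M p.
Proof. by case: ts => //= t ts; apply: geq_minl. Qed.

Lemma low_after M ts p : low M ts p <= after M ts p.
Proof. by elim: ts M => //= t ts IH M; rewrite geq_min IH orbT. Qed.

Fixpoint tight M ts :=
  if ts is t :: ts' then
    [exists d, (0 < gain t d) && (low (fire N M t) ts' d < w + gain t d)]
    && tight (fire N M t) ts'
  else true.

(* The potential [M p - (low M ts p - w)] never decreases along a tight run: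
   the unit lost by a transition is made up for by the gain that makes it
   indispensable. *)
Lemma tight_spread M ts : firable M ts -> tight M ts ->
  \sum_p (M p - (low M ts p - w)) <= spread (after M ts).
Proof.
elim: ts M => [|t ts IH] M /=.
  by move=> _ _; apply: leq_sum => p _; lia.
move=> /andP[/enabledP en f1] /andP[/existsP[d /andP[gd ld]] t1].
apply: leq_trans (IH _ f1 t1).
suff : \sum_p (M p - (minn (M p) (low (fire N M t) ts p) - w) + (p == d)) <=
       \sum_p (fire N M t p - (low (fire N M t) ts p - w) + loss t p).
  by rewrite !big_split /= sum_pred1T; have := sum_loss t; lia.
apply: leq_sum => p _.
have := low_le (fire N M t) ts p; have := en p.
move: ld gd; rewrite /loss /gain.
by case: (eqVneq p d) => [<-|_]; rewrite !fireE; lia.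
Qed.

(** Tokens that stay in excess of [w] throughout the run may be missing: at least [w] remain, which
    is enough for any pre-multiset. *)
Lemma firable_weaken M X ts (g : P -> nat) :
    firable M ts ->
    (forall p, M p <= X p + g p) ->
    (forall p, 0 < g p -> w + g p <= low M ts p) ->
  firable X ts /\ dominates (after X ts) (after M ts).
Proof.
elim: ts M X => [|t ts IH] M X /=.
  by move=> _ h1 h2; split=> // p; have := h1 p; have := h2 p; lia.
move=> /andP[/enabledP en f1] h1 h2.
have enX : enabled N X t.
  apply/enabledP => p.
  by have := en p; have := h1 p; have := h2 p; have := pre_le t p; lia.
rewrite enX; apply: IH f1 _ _ => p; last by move=> /h2; lia.
have := en p; have := h1 p; have := enabledP _ _ _ enX p; rewrite !fireE; lia.
Qed.

Lemma shorten M ts : firable M ts -> ~~ tight M ts ->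
  exists us, [/\ size us < size ts, firable M us
               & dominates (after M us) (after M ts)].
Proof.
elim: ts M => [|t ts IH] M //= /andP[en f1].
rewrite negb_and => /orP[/existsPn nd | /(IH _ f1)[us [sz f d]]]; last first.
  by exists (t :: us); split=> //=; rewrite en.
exists ts; case: (@firable_weaken _ M ts (gain t) f1) => [p|p gp|f d].
- by rewrite fireE /gain; have := enabledP _ _ _ en p; lia.
- by have := nd p; lia.
- by split.
Qed.

Lemma tight_run M ts : firable M ts ->
  exists us, [/\ firable M us, tight M us & dominates (after M us) (after M ts)].
Proof.
elim: {ts}(size ts).+1 {-2}ts (ltnSn (size ts)) => // n IH ts sz f.
have [t|/(shorten f)[us [sz' f' d]]] := boolP (tight M ts).
  by exists ts; split=> // p; lia.
case: (IH us _ f') => [|vs [f2 t2 d2]]; first lia.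
by exists vs; split=> //; apply: dominates_trans d2 d.
Qed.

(** Take a tight run. By maximality the inequality of [tight_spread] is an equality place by place,
    so a place with more than [w] tokens never drops below its initial number. *)
Lemma lazy_run X Y :
    (forall Z, reach X Z -> spread Z <= spread X) -> reach X Y ->
  exists Z, [/\ reach X Z, dominates Z Y, spread Z = spread X
               & forall p, w < X p -> X p <= Z p].
Proof.
move=> max /reachP[ts /tight_run[us [f t d]] ->].
have le1 := tight_spread f t; have le2 := max _ (reach_after f).
have lel p := low_le X us p.
have eqs : forall p, minn (X p) w = X p - (low X us p - w).
  by apply: leq_sum_eq (leq_trans le1 le2) => p; have := lel p; lia.
exists (after X us); split=> //; first exact: reach_after.
  apply/eqP; rewrite eqn_leq le2 /=; apply: leq_trans le1.
  by apply: leq_sum => p _; rewrite eqs.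
move=> p Xp; apply: leq_trans (low_after _ _ _).
by have := eqs p; have := lel p; lia.
Qed.

(** * Steady markings *)

Definition steady X :=
  [/\ forall t, dead_transition N X t \/ live_transition N X t,
      forall Y, reach X Y -> spread Y <= spread X
    & forall Y, reach X Y ->
        exists2 Z, reach Y Z & forall p, minn (Z p) w = minn (X p) w].

Lemma reach_decides (ts : seq T) M : exists2 X, reach M X &
  forall t, t \in ts -> dead_transition N X t \/ live_transition N X t.
Proof.
elim: ts => [|t ts [X rX dl]]; first by exists M => //; apply: reach_refl.
have [l|nl] := classic (live_transition N X t).
  by exists X => // u; rewrite inE => /predU1P[->|/dl //]; right.
have [Y [rY dY]] : exists Y, reach X Y /\ dead_transition N Y t.
  by apply: NNPP => h; apply: nl => Y rY dY; apply: h; exists Y.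
exists Y => [|u]; first exact: reach_trans rX rY.
rewrite inE => /predU1P[->|/dl[]]; first by left.
  by move/(dead_reach rY); left.
by move/(live_transition_reach rY); right.
Qed.

Definition truncation X : {ffun P -> 'I_w.+1} := [ffun p => inord (minn (X p) w)].

Lemma truncation_minn X Y : truncation X = truncation Y ->
  forall p, minn (X p) w = minn (Y p) w.
Proof.
move=> /ffunP e p; have := congr1 val (e p).
by rewrite !ffunE /= !inordK // ltnS geq_minr.
Qed.

(** Each truncation in turn is either recurrent already or can be made unreachable; both properties
    persist along runs. *)
Lemma reach_recurs (ks : seq {ffun P -> 'I_w.+1}) M : exists2 X, reach M X &
  forall k, k \in ks ->
    (forall Y, reach X Y -> exists2 Z, reach Y Z & truncation Z = k) \/
    (forall Y, reach X Y -> truncation Y <> k).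
Proof.
elim: ks => [|k ks [X rX dl]]; first by exists M => //; apply: reach_refl.
have [l|nl] := classic
    (forall Y, reach X Y -> exists2 Z, reach Y Z & truncation Z = k).
  by exists X => // u; rewrite inE => /predU1P[->|/dl //]; left.
have [Y [rY dY]] : exists Y, reach X Y /\ forall Z, reach Y Z -> truncation Z <> k.
  apply: NNPP => h; apply: nl => Y rY; apply: NNPP => h2; apply: h.
  by exists Y; split=> // Z rZ eZ; apply: h2; exists Z.
exists Y => [|u]; first exact: reach_trans rX rY.
rewrite inE => /predU1P[->|/dl[h|h]]; first by right.
  by left=> Z rZ; apply: h; apply: reach_trans rZ.
by right=> Z rZ; apply: h; apply: reach_trans rZ.
Qed.

Lemma reach_max_spread M : exists2 X, reach M X &
  forall Y, reach X Y -> spread Y <= spread X.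
Proof.
have bound X : spread X <= #|P| * w.
  rewrite -sum_nat_const [leqRHS](eq_bigl xpredT) //.
  by apply: leq_sum => p _; apply: geq_minr.
elim: {M}(#|P| * w - spread M).+1 {-2}M (ltnSn (#|P| * w - spread M)) => // n IH M le.
have [h|h] := classic (exists2 Y, reach M Y & spread M < spread Y).
  case: h => Y rY lt; case: (IH Y) => [|X rX mX]; first by have := bound Y; lia.
  by exists X => //; apply: reach_trans rX.
exists M; first exact: reach_refl.
by move=> Y rY; rewrite leqNgt; apply/negP => lt; apply: h; exists Y.
Qed.

Lemma reach_steady M : exists2 X, reach M X & steady X.
Proof.
have [X1 r1 h1] := reach_decides (enum T) M.
have [X2 r2 h2] := reach_recurs (enum {ffun P -> 'I_w.+1}) X1.
have [X r3 mX] := reach_max_spread X2.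
have r13 : reach X1 X by apply: reach_trans r3.
exists X; first exact: reach_trans r13.
split=> // [t|Y rY].
  have [|d|l] := h1 t; first by rewrite mem_enum.
    by left; apply: dead_reach d.
  by right; apply: live_transition_reach l.
have [|h|h] := h2 (truncation X); first by rewrite mem_enum.
  have [|Z rZ e] := h Y; first exact: reach_trans rY.
  by exists Z => // p; apply: truncation_minn.
by case: (h X r3).
Qed.

Lemma nonlive_steady M : ~ live N M ->
  exists X t, [/\ reach M X, steady X & dead_transition N X t].
Proof.
move=> nl; have [t nt] : exists t, ~ live_transition N M t.
  by apply: NNPP => h; apply: nl => t; apply: NNPP => h2; apply: h; exists t.
have [Y [rY dY]] : exists Y, reach M Y /\ dead_transition N Y t.
  by apply: NNPP => h; apply: nt => Y rY dY; apply: h; exists Y.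
have [X rX sX] := reach_steady Y.
exists X, t; split=> //; first exact: reach_trans rX.
exact: dead_reach dY.
Qed.

Lemma steady_reach X Y : steady X -> reach X Y ->
  (forall p, minn (Y p) w = minn (X p) w) -> steady Y.
Proof.
move=> [dl mX cX] rY e.
have es : spread Y = spread X by apply: eq_bigr => p _; rewrite e.
split=> [t|Z rZ|Z rZ].
- by case: (dl t) => [/(dead_reach rY)|/(live_transition_reach rY)]; [left|right].
- by rewrite es; apply: mX; apply: reach_trans rZ.
- have [|V rV eV] := cX Z; first exact: reach_trans rZ.
  by exists V => // p; rewrite e.
Qed.

(* An excess token on a place that loses a token to [t] can be moved by [t];
   by maximality of the spread the places it moves to are full already. *)
Lemma steady_move X Z t : steady X -> reach X Z -> spread Z = spread X ->
    ~ dead_transition N X t -> (forall p, 0 < loss t p -> w < Z p) ->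
  exists Y, [/\ reach Z Y, enabled N Y t, spread Y = spread X,
                forall p, w < Z p -> Z p <= Y p
              & forall p, 0 < gain t p -> w <= Y p].
Proof.
move=> [dl mX _] rZ eZ nd hl.
have mZ Y : reach Z Y -> spread Y <= spread Z.
  by move=> rY; rewrite eZ; apply: mX; apply: reach_trans rY.
have [//|lt] := dl t.
have [Y rY en] := not_dead (lt _ rZ).
have [V [rV /dominates_enabled/(_ en) enV eV hV]] := lazy_run mZ rY.
exists V; split=> //; first by rewrite eV.
have/mZ le : reach Z (fire N V t) by apply: reach_trans (reach_fire enV).
have lew p : minn (V p) w <= minn (fire N V t p) w.
  have := enabledP _ _ _ enV p; have := hl p; have := hV p.
  by have := loss_le1 t p; rewrite fireE /loss; lia.
move=> p; have := leq_sum_eq lew; rewrite -/(spread _) -/(spread _) eV => /(_ le p).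
by rewrite fireE /gain; have := enabledP _ _ _ enV p; lia.
Qed.

(** * Closed sets of places *)

Definition closed t (C : {set P}) :=
  forall p, p \in C -> 0 < loss t p -> forall q, 0 < gain t q -> q \in C.

Lemma steady_region X : steady X -> exists R : {set P},
  [/\ forall p, p \in R -> w <= X p,
      forall p, p \notin R -> X p <= w
    & forall t, ~ dead_transition N X t -> closed t R].
Proof.
move=> sX; have [dl mX cX] := sX.
have [R hR] := finite_comprehension
  (fun p => exists Z, [/\ reach X Z, spread Z = spread X & w < Z p]).
exists R; split=> [p /hR[Z [rZ eZ wZ]]|p|t nd p /hR[Z [rZ eZ wZ]] lp q gq].
- have mZ Y : reach Z Y -> spread Y <= spread Z.
    by move=> rY; rewrite eZ; apply: mX; apply: reach_trans rY.
  have [V rV eV] := cX _ rZ.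
  have [U [rU dU eU hU]] := lazy_run mZ rV.
  have : dominates U X by move=> q; rewrite -eV; apply: dU.
  have le : spread U <= spread X by rewrite eU eZ.
  by move=> /dominates_spread/(_ le p); have := hU p wZ; lia.
- apply: contraR; rewrite -ltnNge => wX; apply/hR.
  by exists X; split=> //; apply: reach_refl.
- have [r|Y [rY enY eY hY gY]] := steady_move sX rZ eZ nd.
    by rewrite (loss_uniq _ lp); case: eqVneq => [->|].
  apply/hR; exists (fire N Y t).
  have rF : reach X (fire N Y t).
    exact: reach_trans rZ (reach_trans rY (reach_fire enY)).
  split=> //.
    apply/eqP; rewrite eqn_leq mX //= -eY; apply: leq_sum => r _.
    have := enabledP _ _ _ enY r; have := loss_uniq r lp; have := hY p wZ.
    by rewrite fireE /loss; case: eqVneq => [->|]; lia.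
  have := gY q gq; move: gq; have := enabledP _ _ _ enY q.
  by rewrite fireE /gain; lia.
Qed.

Lemma closed_simulation (C : {set P}) X X' ts :
    (forall t, ~ dead_transition N X t -> closed t C) ->
    (forall p, p \in C -> w <= X p) -> (forall p, p \notin C -> X' p <= X p) ->
    firable X' ts ->
  exists Y, [/\ reach X Y, forall p, p \in C -> w <= Y p
              & forall p, p \notin C -> after X' ts p <= Y p].
Proof.
elim: ts X X' => [|t ts IH] X X' cl hC hX /=.
  by exists X; split=> //; apply: reach_refl.
move=> /andP[en' f].
have en : enabled N X t.
  apply/enabledP => p; have := enabledP _ _ _ en' p; have := pre_le t p.
  by have [/hC|/hX] := boolP (p \in C); lia.
have nd : ~ dead_transition N X t.
  by move=> /(_ X (reach_refl _ _)); rewrite en.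
have rX : reach X (fire N X t) := reach_fire en.
(* A step that takes a token from [C] is skipped: all its gains lie in [C], so it increases no place
   outside. Any other step is copied, and leaves at least [w] tokens on each place of [C]. *)
have [[s sC ls]|nls] := classic (exists2 s, s \in C & 0 < loss t s).
  apply: IH (cl) hC _ f => p pC; apply: leq_trans (hX p pC).
  have := enabledP _ _ _ en' p; rewrite fireE.
  have : ~~ (0 < gain t p) by apply: contra pC; apply: cl nd _ sC ls _.
  by rewrite /gain; lia.
case: (IH (fire N X t) (fire N X' t)) => // [u nu|p pC|p pC|Y [rY h1 h2]].
- by apply: cl => /(dead_reach rX).
- have lp : ~~ (0 < loss t p) by apply/negP => lp; apply: nls; exists p.
  by have := hC p pC; have := enabledP _ _ _ en p;
    rewrite fireE; rewrite /loss in lp; lia.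
- by rewrite !fireE; have := hX p pC; have := enabledP _ _ _ en' p; lia.
- by exists Y; split=> //; apply: reach_trans rY.
Qed.

Lemma closed_dead (C : {set P}) X X' t :
    (forall t, ~ dead_transition N X t -> closed t C) ->
    (forall p, p \in C -> w <= X p) -> (forall p, p \notin C -> X' p <= X p) ->
  dead_transition N X t -> dead_transition N X' t.
Proof.
move=> cl hC hX d Y' /reachP[ts f ->]; apply/negP => /enabledP en.
have [Y [rY h1 h2]] := closed_simulation cl hC hX f.
have /negP := d Y rY; apply; apply/enabledP => p.
by have := en p; have := pre_le t p; have [/h1|/h2] := boolP (p \in C); lia.
Qed.

(** * Descendants of tokens *)

Section Tokens.

Variable R : {set P}.

(* The number of tokens on each place with a descendant outside [R] at the end
   of the run, the tokens being used in the order most favourable to [R]. *)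
Fixpoint bad M ts : P -> nat :=
  if ts is t :: ts' then
    fun p => minn (bad (fire N M t) ts' p) (M p) +
      [exists q, M q < bad (fire N M t) ts' q] * loss t p
  else fun p => if p \in R then 0 else M p.

Lemma bad_le M ts p : firable M ts -> bad M ts p <= M p.
Proof.
elim: ts M => [|t ts IH] M /=; first by case: ifP.
move=> /andP[en f]; have := IH _ f; have := enabledP _ _ _ en p.
rewrite fireE; have := loss_le1 t p; rewrite /loss.
by case: [exists _, _]; lia.
Qed.

(** Going back over one step adds at most one bad token, on the place [s] that loses it. It replaces
    one that [t] has put on some [q], and [q] is in [C] if [s] is, by closedness. *)
Lemma bad_sum (C : {set P}) M ts : (forall t, closed t C) -> firable M ts ->
  \sum_(p in C) bad M ts p <= \sum_(p in C :\: R) after M ts p.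
Proof.
move=> cl; elim: ts M => [|t ts IH] M /=.
  move=> _; rewrite [leqLHS](bigID (mem R)) /= big1 => [|p /andP[_ ->] //].
  rewrite add0n leq_eqVlt; apply/orP; left; apply/eqP.
  by apply: eq_big => [p|p /andP[_ /negPf->]]; rewrite ?inE 1?andbC.
move=> /andP[en f]; apply: leq_trans (IH _ f).
set B := bad _ ts; set b := [exists _, _].
have [/existsP[q lt]|_] := boolP b; last first.
  by apply: leq_sum => p _; lia.
have gq : 0 < gain t q.
  move: lt (bad_le q f) (enabledP _ _ _ en q); rewrite -/B fireE /gain; lia.
under eq_bigr => p _ do rewrite mul1n.
rewrite big_split /=.
have [[s sC ls]|nls] := classic (exists2 s, s \in C & 0 < loss t s).
  have : \sum_(p in C) (minn (B p) (M p) + (p == q)) <= \sum_(p in C) B p.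
    by apply: leq_sum => p _; case: eqVneq => [->|_]; lia.
  rewrite big_split /= sum_pred1 (cl t s sC ls q gq).
  by have := sum_loss_in t C; lia.
rewrite [X in _ + X]big1 ?addn0 => [|p pC].
  by apply: leq_sum => p _; lia.
by apply/eqP; rewrite -leqn0 leqNgt; apply/negP => lp; apply: nls; exists p.
Qed.

(** Extra tokens on [p] imitate a token there that is not counted by [bad], and so end in [R]. *)
Lemma follow M ts (F : P -> nat) :
    firable M ts -> (forall p, 0 < F p -> bad M ts p < M p) ->
  exists2 E : P -> nat, forall p, 0 < E p -> p \in R &
    reach [ffun p => M p + F p] [ffun p => after M ts p + E p].
Proof.
elim: ts M F => [|t ts IH] M F /=.
  move=> _ h; exists F; last exact: reach_refl.
  by move=> p /h; case: ifP => //; rewrite ltnn.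
move=> /andP[en f]; set B := bad _ ts; set b := [exists _, _] => h.
(* The number of extra tokens that go along with [t]: all those on the place it takes from, unless
   [t] produces a bad token. In that case they stay and imitate a token that stays. *)
pose n := if b then 0 else \sum_p F p * loss t p.
have nl p : n * loss t p <= F p.
  rewrite /n; case: (b) => //.
  have [->|] := posnP (loss t p); first by rewrite muln0.
  move=> lp; rewrite (bigD1 p) //= big1 => [|q qp].
    by have -> : loss t p = 1; [have := loss_le1 t p; lia | lia].
  by rewrite (loss_uniq q lp) (negPf qp) muln0.
pose F1 p := F p - n * loss t p + n * gain t p.
have [|E hE rE] := IH (fire N M t) F1 f.
  move=> p; rewrite -/B fireE => F1p.
  have eM := enabledP _ _ _ en p; have := bad_le p f; rewrite -/B fireE => hB.
  have := h p; have := loss_le1 t p; move: F1p; rewrite /F1 /n.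
  case: (boolP b) => [_|/existsPn nb].
    rewrite !mul0n subn0 addn0 mul1n => Fp l1 /(_ Fp).
    by move: l1 hB eM; rewrite /loss /gain; lia.
  have := nb p; rewrite -/B mul0n addn0.
  have [->|gp] := posnP (gain t p); last by move: gp hB eM; rewrite /loss /gain; lia.
  have [l0|lp] := posnP (loss t p).
    by rewrite l0 !muln0; move: l0 hB eM; rewrite /loss; lia.
  rewrite (bigD1 p) //= big1 => [|q qp]; last first.
    by rewrite (loss_uniq q lp) (negPf qp) muln0.
  by have -> : loss t p = 1; [have := loss_le1 t p; lia | lia].
exists E => //; apply: reach_trans rE.
have [|V rV hV] := @fire_iter _ _ N t n [ffun p => M p + F p].
  move=> p; rewrite ffunE; have := nl p; have := enabledP _ _ _ en p; lia.
apply: reach_trans rV _.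
have enV : enabled N V t.
  apply/enabledP => p; have := enabledP _ _ _ en p; have := hV p.
  by have := nl p; rewrite ffunE; lia.
suff <- : fire N V t = [ffun p => fire N M t p + F1 p] by apply: reach_fire.
apply/ffunP => p; rewrite ffunE !fireE /F1.
have := enabledP _ _ _ en p; have := enabledP _ _ _ enV p; have := hV p.
by have := nl p; rewrite ffunE; lia.
Qed.

(* The places that hold, now or later, a token all of whose descendants end
   in [R]. *)
Fixpoint good_places M ts : {set P} :=
  [set p | bad M ts p < M p] :|:
  (if ts is t :: ts' then good_places (fire N M t) ts' else set0).

Lemma bad_good M ts p : bad M ts p < M p -> p \in good_places M ts.
Proof. by case: ts => [|t ts] h; rewrite /= !inE h. Qed.

Lemma bad_fire_good M t ts p : firable M (t :: ts) ->
    [exists q, M q < bad (fire N M t) ts q] || (loss t p == 0) ->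
    p \in good_places M (t :: ts) -> p \in good_places (fire N M t) ts.
Proof.
move=> /= /andP[en f] h; rewrite !inE => /orP[lt|//]; apply: bad_good.
have := bad_le p f; have := enabledP _ _ _ en p.
move: lt h; rewrite fireE /loss; case: [exists _, _] => /=; lia.
Qed.

(* The tokens with all descendants in [R] need not be copied one by one: it is
   enough to keep [w] of them on each place they visit, from the first visit
   until the last departure.  The weight [r p] is the number of places that
   are first visited from [p], including [p] itself. *)
Lemma regroup M ts (S : {set P}) :
    firable M ts -> S \subset good_places M ts ->
  exists r : P -> nat,
    [/\ forall p, p \in S -> 0 < r p,
        \sum_(p in S) r p <= #|good_places M ts|
      & forall M' : marking P, (forall p, p \notin S -> M' p = M p) ->
          (forall p, p \in S -> bad M ts p + w * r p <= M' p) ->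
        exists2 X, reach M' X & forall p, p \notin R -> X p <= after M ts p].
Proof.
elim: ts M S => [|t ts IH] M S.
  move=> _ sub; exists (fun=> 1); split=> //.
    by rewrite sum_nat_const muln1 subset_leq_card.
  move=> M' hM' _; exists M' => [|p pR]; first exact: reach_refl.
  rewrite hM' //; apply: contra pR => /(subsetP sub).
  by rewrite /= !inE orbF; case: ifP => //; rewrite ltnn.
move=> f sub; have /= /andP[en f1] := f.
set M1 := fire N M t in f1 *; set B := bad M1 ts; set b := [exists _, _].
have fE p : M1 p = M p - pre N t p + post N t p by rewrite fireE.
have Ble p : B p <= M1 p by apply: bad_le.
have eM := enabledP _ _ _ en.
have badE p : bad M (t :: ts) p = minn (B p) (M p) + b * loss t p by [].
have O1O : #|good_places M1 ts| <= #|good_places M (t :: ts)|.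
  by apply/subset_leq_card/subsetUr.
(* Here one firing of [t] in [M'] is enough: either the token taken is bad, and bad tokens are
   copied one by one, or [t] takes nothing from [S]. *)
have [one|] := classic (b \/ forall s, s \in S -> loss t s = 0).
  have [|r [r0 rS hr]] := IH M1 S f1.
    apply/subsetP => p pS; apply: bad_fire_good f _ (subsetP sub _ pS).
    by rewrite -/M1 -/B -/b; case: one => [->|/(_ p pS)->] //; rewrite eqxx orbT.
  exists r; split=> // [|M' hN hS]; first exact: leq_trans O1O.
  have en' : enabled N M' t.
    apply/enabledP => p; have [pS|/hN->//] := boolP (p \in S).
    apply: leq_trans (pre_le t p) (leq_trans _ (hS p pS)).
    by rewrite (leq_trans _ (leq_addl _ _)) // leq_pmulr // r0.
  have [p pS|p pS|X rX hX] := hr (fire N M' t).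
  - by rewrite fireE hN // fE.
  - have := hS p pS; have := enabledP _ _ _ en' p; have := Ble p; have := eM p.
    rewrite -/B fireE fE.
    move: (w * r p) => k; case: one => [->|/(_ p pS)]; rewrite ?mul1n /loss.
      by clear; lia.
    by move=> l0; rewrite l0 muln0; move: l0; clear; lia.
  - by exists X => //; apply: reach_trans (reach_fire en') rX.
move=> none; have bF : ~~ b by apply/negP => hb; apply: none; left.
have [s sS ls] : exists2 s, s \in S & 0 < loss t s.
  apply: NNPP => h; apply: none; right=> s sS; apply/eqP.
  by rewrite -leqn0 leqNgt; apply/negP => ls; apply: h; exists s.
have nb p : B p <= M p.
  by move/existsPn: bF => /(_ p); rewrite -leqNgt.
have lossE p : loss t p = (p == s) by apply: loss_uniq.
have l1 : loss t s = 1 by rewrite lossE eqxx.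
have {}badE p : bad M (t :: ts) p = B p.
  by rewrite badE (negPf bF) mul0n addn0; apply/minn_idPl.
set O1 := good_places M1 ts in O1O.
pose G := [set q | 0 < gain t q].
have GO1 : G \subset O1.
  apply/subsetP => q; rewrite inE => gq; apply: bad_good.
  by have := nb q; rewrite -/B fE; move: gq; rewrite /gain; clear; lia.
have SO1 p : p \in S -> p != s -> p \in O1.
  move=> pS ps; apply: bad_fire_good f _ (subsetP sub _ pS).
  by rewrite lossE (negPf ps) orbT.
have sG : s \notin G by rewrite inE; move: l1; rewrite /loss /gain; clear; lia.
(* The places to handle after the step: those of [S] that are still good, and those that [t] feeds,
   all good because [b] fails. *)
have [|r [r0 rS hr]] := IH M1 ((S :&: O1) :|: G) f1.
  by rewrite subUset GO1 subsetIr.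
rewrite -/O1 in rS.
(* What [s] has to provide, in units of [w], for the new places outside [S]. *)
pose c := \sum_(q in G :\: S) r q.
have rSE : \sum_(p in (S :&: O1) :|: G) r p = \sum_(p in S :&: O1) r p + c.
  rewrite (bigID (mem S)) /= /c; congr (_ + _); apply: eq_bigl => p; rewrite !inE.
    have [pS|] := boolP (p \in S); rewrite ?andbF // andbT.
    have [//|pO] := boolP (p \in O1); rewrite orFb.
    by apply: contraNF pO => gp; apply: (subsetP GO1); rewrite inE.
  by case: (p \in S); rewrite ?andbF //= andbT.
(* If [s] is not in [O1], its own share is no longer needed. The maximum with 1 keeps the weight
   positive; it is paid for by [s] itself, which is a good place before the step but not after
   it. *)
exists (fun p => if p == s then (if s \in O1 then r s + c else maxn 1 c) else r p).
split=> [p pS||M' hN hS].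
- case: (eqVneq p s) => [ps|/(SO1 _ pS) pO]; last by apply: r0; rewrite !inE pS pO.
  case: ifP => sO; last by rewrite leq_max.
  by rewrite addn_gt0 r0 // !inE sS sO.
- rewrite (bigD1 s) //= eqxx.
  under eq_bigr => p /andP[_ /negPf->] do [].
  have [sO|sO] := boolP (s \in O1).
    apply: leq_trans O1O; apply: leq_trans rS; rewrite rSE.
    have -> : S :&: O1 = S.
      apply/setIidPl/subsetP => p pS.
      by have [->//|] := eqVneq p s; apply: SO1.
    by rewrite [\sum_(_ in S) _](bigD1 s) //= addnAC.
  have lt : #|O1| < #|good_places M (t :: ts)|.
    apply: proper_card; apply/properP; split; first exact: subsetUr.
    by exists s => //; apply: (subsetP sub).
  have e : \sum_(p in S :&: O1) r p = \sum_(p in S | p != s) r p.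
    apply: eq_bigl => p; rewrite inE; have [pS|//] := boolP (p \in S).
    by case: (eqVneq p s) => [->|/(SO1 _ pS)] //; apply/negbTE.
  rewrite -e; apply: leq_trans lt.
  apply: leq_trans (_ : (\sum_(p in S :&: O1) r p + c).+1 <= _).
    by rewrite addnC -addnS leq_add2l geq_max ltn0Sn leqnSn.
  by rewrite ltnS -rSE.
(* [t] is repeated [w * c] times if [s] is still good afterwards, and otherwise until only the [B s]
   bad tokens are left on [s]. *)
- pose n := if s \in O1 then w * c else M' s - B s.
  have {}hS p : p \in S -> B p + w * (if p == s then
      (if s \in O1 then r s + c else maxn 1 c) else r p) <= M' p.
    by move=> pS; rewrite -badE; apply: hS.
  have := hS s sS; rewrite eqxx => hs.
  have hp p : p \in S -> p != s -> B p + w * r p <= M' p.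
    by move=> pS ps; have := hS p pS; rewrite (negPf ps).
  have Bs : s \notin O1 -> B s = M1 s.
    move=> sO; have := contraNN (@bad_good M1 ts s) sO; have := Ble s.
    by rewrite -/B; move: (B s) (M1 s); clear; lia.
  have nc : w * c <= n.
    rewrite /n; case: ifP hs => // _ hs; apply: leq_trans (_ : w * maxn 1 c <= _).
      by rewrite leq_mul2l leq_maxr orbT.
    by move: hs; clear; lia.
  have rc q : q \in G -> q \notin S -> r q <= c.
    by move=> qG qS; rewrite /c (bigD1 q) ?leq_addr // !inE qS; rewrite inE in qG.
  have [|V rV hV] := @fire_iter _ _ N t n M'.
    move=> p; rewrite lossE; have [->|ps] := eqVneq p s.
      rewrite muln1 /n; case: ifP hs => [sO|/negbT/Bs eB] hs.
        have : 0 < r s by apply: r0; rewrite !inE sS sO.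
        move=> rs; apply: leq_trans (_ : w * c + w * r s <= _).
          rewrite leq_add2l geq_min; apply/orP; left.
          by apply: leq_trans (pre_le t s) _; rewrite leq_pmulr.
        by move: hs; rewrite mulnDr; clear; lia.
      by move: hs; have := eM s; move: l1; rewrite eB fE /loss; clear; lia.
    rewrite muln0 add0n; apply: leq_trans (geq_minl _ _) _.
    have [pS|pS] := boolP (p \in S); last by rewrite hN.
    have : 0 < r p by apply: r0; rewrite !inE pS SO1.
    move=> rp; apply: leq_trans (pre_le t p) _.
    apply: leq_trans (leq_trans (leq_addl (B p) _) (hp p pS ps)).
    by rewrite leq_pmulr.
  have [p|p|X rX hX] := hr V.
  + rewrite !inE negb_or negb_and => /andP[nSO]; rewrite -eqn0Ngt => /eqP g0.
    have := hV p; rewrite g0 muln0 addn0 lossE fE; have [ps|ps] := eqVneq p s.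
      have sO : s \notin O1 by move: nSO; rewrite ps sS.
      move: hs; rewrite ps muln1 /n (negPf sO) => hs; have := Bs sO.
      by rewrite fE; move: hs; clear; lia.
    have pS : p \notin S by case/orP: nSO => // pO; apply: contra pO => /SO1->.
    rewrite muln0 addn0 => ->; rewrite hN //; have := lossE p; have := eM p.
    by move: g0; rewrite (negPf ps) /loss /gain; clear; lia.
  + rewrite !inE; have := hV p; rewrite lossE; have [->|ps] := eqVneq p s.
      rewrite -/B sS /= => hVs /orP[sO|]; last by move: sG; rewrite inE => /negPf->.
      by move: hVs hs; rewrite /n sO muln1 mulnDr; clear; lia.
    rewrite muln0 addn0 -/B => ->; have [pS _|pS] := boolP (p \in S).
      by apply: leq_trans (hp p pS ps) (leq_addr _ _).
    rewrite /= => gp; rewrite hN //; apply: leq_add (nb p) _.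
    have rcp : r p <= c by apply: rc; rewrite ?inE.
    apply: leq_trans (leq_mul (leqnn w) rcp) (leq_trans nc _).
    by rewrite leq_pmulr.
  + by exists X => //; apply: reach_trans rV rX.
Qed.

End Tokens.

(** * Small live markings and large markings *)

Lemma dead_outside X t (R : {set P}) :
    (forall p, p \in R -> w <= X p) -> (forall p, p \notin R -> X p <= w) ->
  dead_transition N X t -> \sum_(p in ~: R) X p < w * #|P|.
Proof.
move=> hR hX d; have [v lt] : exists v, X v < w.
  apply: NNPP => h; have /negP := d X (reach_refl _ _); apply.
  apply/enabledP => p; apply: leq_trans (pre_le t p) _.
  by rewrite leqNgt; apply/negP => lt; apply: h; exists p.
have vR : v \in ~: R by rewrite inE; apply/negP => /hR; rewrite leqNgt lt.
have : \sum_(p in ~: R) (X p + (p == v)) <= \sum_(p in ~: R) w.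
  apply: leq_sum => p; rewrite inE => /hX; case: eqVneq => [->|_]; lia.
rewrite big_split /= sum_pred1 vR addn1 => /leq_trans; apply.
by rewrite sum_nat_const mulnC leq_mul2l max_card orbT.
Qed.

Lemma bad_lt (R : {set P}) M ts t p : firable M ts ->
    (forall q, q \in R -> w <= after M ts q) ->
    (forall q, q \notin R -> after M ts q <= w) ->
  dead_transition N (after M ts) t -> bad R M ts p < w * #|P|.
Proof.
move=> f hR hX d; apply: leq_ltn_trans (dead_outside hR hX d).
have cl u : closed u setT by move=> ? _ _ ? _; rewrite inE.
have := bad_sum R cl f; rewrite setTD; apply: leq_trans.
by rewrite (bigD1 p) ?inE //= leq_addr.
Qed.

Lemma nonlive_agree M M' :
    (forall p, M' p = M p \/ 2 * w * #|P| <= M p /\ 2 * w * #|P| <= M' p) ->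
  ~ live N M -> ~ live N M'.
Proof.
move=> agree /nonlive_steady[X [t [/reachP[ts f ->] sX d]]] l.
have [R [hR hX cl]] := steady_region sX.
have lt p : bad R M ts p < w * #|P| by apply: bad_lt d.
pose S := [set p | (2 * w * #|P| <= M p) && (2 * w * #|P| <= M' p)].
have sub : S \subset good_places R M ts.
  apply/subsetP => p; rewrite inE => /andP[h _]; apply: bad_good.
  by have := lt p; move: h; rewrite -mulnA; move: (w * _); lia.
have [r [r0 rS hr]] := regroup f sub.
have [p|p pS|X' rX' hX'] := hr M'.
- by rewrite inE; case: (agree p) => // -[-> ->].
(* Fewer than [w * #|P|] bad tokens, and at most [w * #|P|] tokens for regrouping: hence the factor
   2. *)
- have rp : r p <= #|P|.
    apply: leq_trans (leq_trans rS (max_card _)).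
    by rewrite (bigD1 p) //= leq_addr.
  have := pS; rewrite inE => /andP[_]; apply: leq_trans.
  have : w * r p <= w * #|P| by rewrite leq_mul2l rp orbT.
  by have := lt p; rewrite -mulnA; move: (w * r p) (w * _) => a b; lia.
- by apply: (l t _ rX'); apply: closed_dead cl hR hX' d.
Qed.

Lemma live_agree M M' :
    (forall p, M' p = M p \/ 2 * w * #|P| <= M p /\ 2 * w * #|P| <= M' p) ->
  live N M <-> live N M'.
Proof.
move=> agree; split=> l; apply: NNPP => nl; last exact: nonlive_agree nl l.
by apply: nonlive_agree nl l => p; case: (agree p) => [|[]]; [left|right].
Qed.

Lemma live_small M : live N M ->
  exists M', live N M' /\ forall p, M' p <= w * #|P|.
Proof.
elim: {M}(msize M).+1 {-2}M (ltnSn (msize M)) => // n IH M leM l.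
have [h|/not_all_ex_not[p /negP]] := classic (forall p, M p <= w * #|P|).
  by exists M.
rewrite -ltnNge => lt; pose J : marking P := [ffun q => M q - (q == p)].
have JE q : J q + (q == p) = M q.
  by rewrite ffunE; case: eqVneq => [->|_]; lia.
have [lJ|/nonlive_steady[X [t [/reachP[ts f ->] sX d]]]] := classic (live N J).
  apply: IH lJ; rewrite ltnS in leM; apply: leq_trans leM.
  rewrite /msize (eq_bigr _ (fun q _ => esym (JE q))) big_split /=.
  by rewrite sum_pred1T addn1.
have [R [hR hX cl]] := steady_region sX.
(* [J] still has at least [w * #|P|] tokens on [p], so one of them is not bad; the removed token,
   put back, follows it. *)
have [q|E hE rE] := follow (R := R) (F := fun q => q == p) f.
  rewrite lt0b => /eqP->; apply: leq_trans (bad_lt _ f hR hX d) _.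
  by have := JE p; rewrite eqxx; lia.
have JM : [ffun q => J q + (q == p)] = M by apply/ffunP => q; rewrite ffunE JE.
rewrite JM in rE; case: (l t _ rE).
apply: closed_dead cl hR _ d => q qR; rewrite ffunE.
by have [->|/hE] := posnP (E q); [rewrite addn0 | rewrite (negPf qR)].
Qed.

Lemma reach_add X Y (F : P -> nat) : reach X Y ->
  reach [ffun p => X p + F p] [ffun p => Y p + F p].
Proof.
elim=> [Z V [t en ->]|Z|X1 X2 X3 _ h1 _ h2]; last exact: reach_trans h1 h2.
  have en' : enabled N [ffun p => Z p + F p] t.
    by apply/enabledP => p; rewrite ffunE; have := enabledP _ _ _ en p; lia.
  suff -> : [ffun p => fire N Z t p + F p] = fire N [ffun p => Z p + F p] t.
    exact: reach_fire.
  apply/ffunP => p; rewrite fireE !ffunE.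
  by have := enabledP _ _ _ en p; rewrite !ffunE; lia.
exact: reach_refl.
Qed.

(** * Conservative nets *)

Section Conservative.

Hypothesis conservative : forall t, \sum_p gain t p = \sum_p loss t p.

Lemma reach_msize X Y : reach X Y -> msize Y = msize X.
Proof.
elim=> [Z V [t en ->]|//|X1 X2 X3 _ -> _ -> //].
apply/eqP; rewrite -(eqn_add2r (\sum_p loss t p)) -{2}conservative -!big_split.
apply/eqP/eq_bigr => p _ /=; rewrite fireE /loss /gain.
by have := enabledP _ _ _ en p; lia.
Qed.

Lemma gain_uniq t p q : 0 < gain t q -> gain t p = (p == q).
Proof.
have := sum_loss t; rewrite -conservative => le gq; move: le.
rewrite (bigD1 q) //=; have [->|pq] := eqVneq p q; first lia.
by rewrite (bigD1 p) //=; lia.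
Qed.

(** The number of tokens is constant, so equal spreads mean equal total excess over [w]. *)
Lemma excess_eq X Y : reach X Y -> spread Y = spread X ->
  (forall p, w < X p -> X p <= Y p) -> forall p, X p - w = Y p - w.
Proof.
move=> /reach_msize eS eF le; apply: leq_sum_eq => [p|]; first by have := le p; lia.
have sE Z : msize Z = spread Z + \sum_p (Z p - w).
  by rewrite -big_split /=; apply: eq_bigr => p _; lia.
by move: eS; rewrite !sE eF => /addnI->.
Qed.

Lemma steady_shift X t p q : steady X -> ~ dead_transition N X t ->
    w < X p -> 0 < loss t p -> 0 < gain t q ->
  w <= X q /\ exists2 Y, reach X Y & forall r, Y r + (r == p) = X r + (r == q).
Proof.
move=> sX nd wX lp gq; have [_ mX cX] := sX.
have lE r : loss t r = (r == p) by apply: loss_uniq.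
have gE r : gain t r = (r == q) by apply: gain_uniq.
have [r|Y [rY enY eY hY gY]] := steady_move sX (reach_refl _ _) erefl nd.
  by rewrite lE; case: eqVneq => [->|].
have exY := excess_eq rY eY hY.
have qp : (q == p) = false.
  by apply/eqP => e; move: lp gq; rewrite e /loss /gain; lia.
pose Z := fire N Y t.
have ZE r : Z r + (r == p) = Y r + (r == q).
  by rewrite -lE -gE fireE /loss /gain; have := enabledP _ _ _ enY r; lia.
have rZ : reach X Z by apply: reach_trans rY (reach_fire enY).
have wY := gY q gq.
have eZ : spread Z = spread X.
  apply/eqP; rewrite eqn_leq mX //= -eY; apply: leq_sum => r _.
  by have := ZE r; have := hY p wX; case: (eqVneq r p) => [->|]; lia.
have mZ V : reach Z V -> spread V <= spread Z.
  by move=> rV; rewrite eZ; apply: mX; apply: reach_trans rV.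
(* After [t], a lazy run restores the truncation of [X]. By [excess_eq] it leaves every excess as it
   is, so the net effect is that one token has moved from [p] to [q]. *)
have [V rV eV] := cX _ rZ.
have [U [rU dU eU hU]] := lazy_run mZ rV.
have UX : forall r, minn (X r) w = minn (U r) w.
  apply: dominates_spread; last by rewrite eU eZ.
  by move=> r; rewrite -eV; apply: dU.
have exU := excess_eq rU eU hU.
have wXq : w <= X q.
  by have := UX q; have := exU q; have := ZE q; rewrite eqxx qp; lia.
split=> //; exists U; first exact: reach_trans rU.
move=> r; have := UX r; have := exU r; have := ZE r; have := exY r.
case: (eqVneq r p) => [->|_]; first by rewrite eq_sym qp; have := hY p wX; lia.
by case: (eqVneq r q) => [->|_]; lia.
Qed.

Definition edge p q := [exists t, (0 < loss t p) && (0 < gain t q)].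

Lemma steady_path X p s : steady X -> live N X -> w < X p -> path edge p s ->
  w <= X (last p s) /\
  exists2 Y, reach X Y & forall r, Y r + (r == p) = X r + (r == last p s).
Proof.
elim: s X p => [|q s IH] X p sX lX wX /=.
  by move=> _; split; [lia | exists X => //; apply: reach_refl].
move=> /andP[/existsP[t /andP[lp gq]] ps].
have [wq [Y rY YE]] := steady_shift sX (lX t X (reach_refl _ _)) wX lp gq.
have sY : steady Y.
  apply: steady_reach sX rY _ => r; have := YE r.
  by case: (eqVneq r p) => [->|_]; case: (eqVneq _ q) => [->|_]; lia.
have [|wl [Z rZ ZE]] := IH Y q sY (live_reach rY lX) _ ps.
  by have := YE q; rewrite eqxx; case: eqVneq => [->|_]; lia.
split; last first.
  by exists Z; [apply: reach_trans rZ | move=> r; have := YE r; have := ZE r; lia].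
have := YE (last q s); case: (eqVneq _ p) => [->|_]; first lia.
by case: (eqVneq _ q) => [->|_]; lia.
Qed.

Lemma live_small_conservative M : live N M ->
  exists M', live N M' /\ forall p, M' p <= w.
Proof.
elim: {M}(msize M).+1 {-2}M (ltnSn (msize M)) => // n IH M leM lM.
have [X rX sX] := reach_steady M; have lX := live_reach rX lM.
have [h|/not_all_ex_not[p /negP]] := classic (forall p, X p <= w).
  by exists X.
rewrite -ltnNge => wX; pose J : marking P := [ffun q => X q - (q == p)].
have JE q : J q + (q == p) = X q.
  by rewrite ffunE; case: eqVneq => [->|_]; lia.
have [lJ|/nonlive_steady[L [t [/reachP[ts f ->] sL d]]]] := classic (live N J).
  apply: IH lJ; rewrite ltnS in leM; apply: leq_trans leM.
  rewrite -(reach_msize rX) /msize (eq_bigr _ (fun q _ => esym (JE q))) big_split /=.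
  by rewrite sum_pred1T addn1.
have [R [hR hL cl]] := steady_region sL.
pose C := [set v | connect edge p v].
have clC u : closed u C.
  move=> v; rewrite !inE => pv lv q gq; rewrite inE; apply: connect_trans pv _.
  by apply: connect1; apply/existsP; exists u; rewrite lv gq.
have hC v : v \in C -> w <= X v /\
    exists2 Y, reach X Y & forall r, Y r + (r == p) = X r + (r == v).
  by rewrite inE => /connectP[s ps ->]; apply: steady_path.
have [[v vC lt]|none] := classic (exists2 v, v \in C & bad R J ts v < J v).
  have [_ [Y rY YE]] := hC v vC.
  have [q|E hE rE] := follow (R := R) (F := fun q => q == v) f.
    by rewrite lt0b => /eqP->.
  have JY : [ffun q => J q + (q == v)] = Y.
    by apply/ffunP => q; rewrite ffunE; have := JE q; have := YE q; lia.
  rewrite JY in rE; case: (lX t _ (reach_trans rY rE)).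
  apply: closed_dead cl hR _ d => q qR; rewrite ffunE.
  by have [->|/hE] := posnP (E q); [rewrite addn0 | rewrite (negPf qR)].
(* The bad tokens, at least [w] for each place of [C], amount to no more than what ends in
   [C :\: R], where no place holds more than [w]. So every place of [C] ends with at least [w], and
   a token put back on [p] is of no use. *)
have le : w * #|C| <= \sum_(v in C :\: R) after J ts v.
  apply: leq_trans (bad_sum R clC f); rewrite mulnC -sum_nat_const.
  apply: leq_sum => v vC; apply: leq_trans (_ : J v <= _); last first.
    by rewrite leqNgt; apply/negP => lt; apply: none; exists v.
  have [wv _] := hC v vC; have := JE v.
  by case: (eqVneq v p) => [->|_]; lia.
have hC' v : v \in C -> w <= after J ts v.
  move=> vC; have [/hR //|vR] := boolP (v \in R).
  rewrite leqNgt; apply/negP => lt.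
  have : \sum_(q in C :\: R) (after J ts q + (q == v)) <= \sum_(q in C :\: R) w.
    apply: leq_sum => q; rewrite inE => /andP[/hL qL _].
    by case: eqVneq => [->|_]; lia.
  rewrite big_split /= sum_pred1 inE vR vC /= addn1 => /(leq_ltn_trans le).
  by rewrite sum_nat_const mulnC ltn_mul2r andbC ltnNge subset_leq_card ?subsetDl.
have := reach_add (fun q => q == p) (reach_after f).
have -> : [ffun q => J q + (q == p)] = X by apply/ffunP => q; rewrite ffunE JE.
move=> rL; case: (lX t _ rL); apply: (closed_dead (fun u _ => clC u) hC' _ d) => q.
by rewrite ffunE inE; case: eqVneq => [->|_]; rewrite ?connect0 ?addn0.
Qed.

End Conservative.

End Capped.

Lemma sum_option (P : finType) (F : option P -> nat) :
  \sum_q F q = F None + \sum_p F (Some p).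
Proof.
rewrite (bigD1 None) //=; congr (_ + _).
rewrite (reindex_omap Some id) /=; last by case.
by apply: eq_bigl => p; rewrite eqxx.
Qed.

(** * Net types *)

Section Types.

Variables (P T : finType) (N : net P T).
Implicit Types (t : T) (p : P).

Lemma weight_le_max x : weight N x <= max_weight N.
Proof.
rewrite /max_weight; case: ifP => [/forallP -> //|_].
exact: (leq_bigmax x).
Qed.

Lemma pre_le_max t p : pre N t p <= max_weight N.
Proof. by rewrite ffunE weight_le_max. Qed.

Lemma max_weight_ordinary : ordinary N -> max_weight N = 1.
Proof. by rewrite /max_weight => ->. Qed.

Lemma msize_msingle (A : finType) (a : A) : msize (msingle a) = 1.
Proof.
by rewrite /msize (bigD1 a) //= ffunE eqxx big1 // => b /negPf nb; rewrite ffunE nb.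
Qed.

Lemma msize_madd (A : finType) (X Y : multiset A) :
  msize (madd X Y) = msize X + msize Y.
Proof. by rewrite /msize -big_split; apply: eq_bigr => a _; rewrite ffunE. Qed.

Lemma BIO_BIMO t : BIO_transition N t -> BIMO_transition N t.
Proof. by case=> s [O [D [h _]]]; apply/BIMO_transitionP; exists s, O, D. Qed.

Lemma IMO_BIMO t : IMO_transition N t -> BIMO_transition N t.
Proof. by case=> s [O [D [h _]]]; apply/BIMO_transitionP; exists s, O, D. Qed.

(** The extended pre- and post-multisets both have size [1 + msize O]; the dummy place contributes
    equally to both and cancels. *)
Lemma IMO_conservative t : IMO_transition N t ->
  \sum_p gain N t p = \sum_p loss N t p.
Proof.
case=> s [O [D [[hpre hpost] hD]]].
have : msize (dummy_extend N t (pre N t)) = msize (dummy_extend N t (post N t)).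
  by rewrite hpre hpost !msize_madd hD msize_msingle addnC.
rewrite /msize !sum_option ![dummy_extend _ _ _ None]ffunE => /addnI.
under eq_bigr => p _ do rewrite ffunE.
under [in RHS]eq_bigr => p _ do rewrite ffunE.
move=> e; apply/eqP; rewrite -(eqn_add2l (\sum_p pre N t p)) {2}e -!big_split.
by apply/eqP/eq_bigr => p _ /=; rewrite /gain /loss; lia.
Qed.

Lemma BIO_pre_le t p : BIO_transition N t -> pre N t p <= 2.
Proof.
case=> s [O [D [[/ffunP hpre _] hO]]]; have := hpre (Some p).
rewrite [LHS]ffunE [RHS]ffunE => ->.
apply: (@leq_add _ _ 1 1); first by rewrite ffunE leq_b1.
by apply: leq_trans hO; rewrite /msize (bigD1 (Some p)) //= leq_addr.
Qed.

Lemma live_determined w B :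
    (forall t, BIMO_transition N t) -> (forall t p, pre N t p <= w) ->
    B = 2 * w * #|P| ->
  (forall M M' : marking P,
      small_places B M = small_places B M' ->
      {in small_places B M, M =1 M'} -> (live N M <-> live N M')) /\
  (forall M : marking P, live N M <-> live N (cap B M)).
Proof.
move=> bimo prew eB; split=> [M M' /setP e h|M]; apply: (live_agree bimo prew) => p.
  have := e p; rewrite !inE -eB => ep.
  have [lt|ge] := ltnP (M p) B; first by left; rewrite h // inE.
  by right; split=> //; rewrite leqNgt -ep -leqNgt.
rewrite ffunE -eB; case: ltnP => [/ltnW|]; last by left.
by right.
Qed.

End Types.

Theorem theorem2p5 (P T : finType) (N : net P T) (ty : net_type) (B1 B2 : nat) :
  has_type N ty ->
  structurally_live N ->
  (B1, B2) = bounds N ty ->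
  [/\ exists M : marking P, live N M /\ (forall p : P, M p <= B1),
      forall M M' : marking P,
        small_places B2 M = small_places B2 M' ->
        {in small_places B2 M, M =1 M'} ->
        (live N M <-> live N M')
    & forall M : marking P, live N M <-> live N (cap B2 M)].
Proof.
move=> hty [M lM] hB.
(* [w] has to bound the weights of edges into transitions: it is 1 for ordinary nets, 2 for IO nets,
   and [max_weight N] otherwise. *)
suff [w [bimo prew e1 e2]] : exists w,
    [/\ forall t, BIMO_transition N t, forall t p, pre N t p <= w,
        B2 = 2 * w * #|P|
      & B1 = w * #|P| \/
        B1 = w /\ forall t, \sum_p gain N t p = \sum_p loss N t p].
  have [h2 h3] := live_determined bimo prew e1; split=> //.
  case: e2 => [->|[-> cons]]; first exact (live_small bimo prew lM).
  exact (live_small_conservative bimo prew cons lM).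
have prew := pre_le_max N.
case: ty hty hB => /= => [[o h]|[o h]|h|h|[o h]|[o h]|h|h] [-> ->].
- exists 1; rewrite -{1}(max_weight_ordinary o) muln1.
  split=> // [t|]; first by apply: IMO_BIMO; case: (h t).
  by right; split=> // t; apply: IMO_conservative; case: (h t).
- exists 1; rewrite -{1}(max_weight_ordinary o) muln1.
  split=> // [t|]; first exact: IMO_BIMO.
  by right; split=> // t; apply: IMO_conservative.
- exists 2; split=> // [t|t p|]; first by apply: IMO_BIMO; case: (h t).
    by apply: BIO_pre_le; case: (h t).
  by right; split=> // t; apply: IMO_conservative; case: (h t).
- exists (max_weight N); split=> // [t|]; first exact: IMO_BIMO.
  by right; split=> // t; apply: IMO_conservative.
- exists 1; rewrite -{1}(max_weight_ordinary o) muln1 mul1n.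
  by split=> // [t|]; [apply: BIO_BIMO | left].
- by exists 1; rewrite -{1}(max_weight_ordinary o) muln1 mul1n; split=> //; left.
- by exists (max_weight N); split=> // [t|]; [apply: BIO_BIMO | left].
- by exists (max_weight N); split=> //; left.
Qed.
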